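(* For every integer $n\ge3$, there is a connected signed graph with $6n$ vertices, maximum degree $5$, and chromatic number $3$, such that its largest eigenvalue appears with multiplicity $n$.
   Context: A signed graph is a finite simple graph each of whose edges is labeled positive or negative; its eigenvalues are those of its signed adjacency matrix (entry $1$ for a positive edge, $-1$ for a negative edge, $0$ otherwise). Degree and connectivity refer to the underlying graph. A valid $t$-coloring of a signed graph is a vertex coloring with $t$ colors such that the endpoints of every negative edge get distinct colors and the endpoints of every positive edge get the same color; the chromatic number is the least $t$ for which a valid $t$-coloring exists. *)

(* Defs.v *)
From HB Require Import structures.
From mathcomp Require Import all_boot all_order all_algebra.
From mathcomp Require Import reals.

Set Implicit Arguments.
Unset Strict Implicit.
Unset Printing Implicit Defensive.

Import Order.TTheory GRing.Theory Num.Theory.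
Local Open Scope ring_scope.

(* [sg_pos u v] is the label of the edge uv (true for positive); it is        *)
(* irrelevant when u and v are not adjacent.                                  *)
Record sgraph (V : finType) := SGraph {
  sg_adj : rel V;
  sg_pos : rel V;
  sg_adj_sym : symmetric sg_adj;
  sg_adj_irr : irreflexive sg_adj;
  sg_pos_sym : forall u v, sg_adj u v -> sg_pos u v = sg_pos v u
}.

Section SignedGraph.
Variables (V : finType) (G : sgraph V).

Definition pos_edge (u v : V) : bool := sg_adj G u v && sg_pos G u v.
Definition neg_edge (u v : V) : bool := sg_adj G u v && ~~ sg_pos G u v.

Definition degree (v : V) : nat := #|[set u | sg_adj G v u]|.

Definition max_degree : nat := \max_(v : V) degree v.

Definition connected_sgraph : Prop := forall u v : V, connect (sg_adj G) u v.

Definition valid_coloring (t : nat) (c : V -> 'I_t) : Prop :=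
  forall u v : V,
    (neg_edge u v -> c u <> c v) /\ (pos_edge u v -> c u = c v).

Definition valid_colorable (t : nat) : Prop :=
  exists c : V -> 'I_t, valid_coloring c.

(* A predicate rather than a function: a signed graph need not admit a valid  *)
(* coloring with any number of colors.                                        *)
Definition chromatic_number (t : nat) : Prop :=
  valid_colorable t /\ forall s : nat, valid_colorable s -> (t <= s)%N.

(* Rows and columns follow the enumeration of V.                              *)
Definition signed_adjacency (R : nzRingType) : 'M[R]_#|V| :=
  \matrix_(i, j)
    if pos_edge (enum_val i) (enum_val j) then 1
    else if neg_edge (enum_val i) (enum_val j) then -1
    else 0.

End SignedGraph.

Definition largest_eigenvalue (R : realType) (m : nat) (A : 'M[R]_m) (lam : R)
    : Prop :=
  eigenvalue A lam /\ forall mu : R, eigenvalue A mu -> mu <= lam.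

Definition eigenvalue_multiplicity (R : realType) (m : nat) (A : 'M[R]_m)
    (lam : R) : nat :=
  mup lam (char_poly A).

(* Main.v *)
(* Take n copies of K5, 2-colored so that both colors occur; up to switching   *)
(* by the colors each is an ordinary K5, with simple top eigenvalue 4. Join    *)
(* them in a ring by n vertices of the third color, each attached to one       *)
(* vertex of either color in two consecutive copies: the contributions of the  *)
(* switched constant vector of a copy at such a connector cancel, so these n   *)
(* vectors remain eigenvectors for 4. Conversely, for an eigenvalue mu >= 4    *)
(* the equations at the neighbors of a connector give mu (mu + 1) w = 4 w for  *)
(* the value w at that connector, so w = 0 and the copies decouple.            *)

Require Import Defs.
From mathcomp Require Import all_boot all_order all_algebra.
From mathcomp Require Import reals.
From mathcomp Require Import ring lra.

Set Implicit Arguments.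
Unset Strict Implicit.
Unset Printing Implicit Defensive.

Import Order.TTheory GRing.Theory Num.Theory.
Local Open Scope ring_scope.

(** Multiplicity is counted in the characteristic polynomial; for a symmetric matrix it is the
    dimension of the eigenspace ([mup_char_poly_sym]). The eigenvalue equations of the ring of
    copies are solved for all [mu >= 4] at once ([local_equations_solution]): at 4 one free
    parameter per copy remains, so the eigenspace has dimension [n], and above 4 only the zero
    vector survives, so 4 is the largest eigenvalue. Edge signs are read off a 3-coloring, which is
    therefore valid, and a triangle of negative edges rules out fewer colors. *)

(** Scalar matrices commute with [P], so [P] also intertwines the characteristic matrices; take
    determinants and cancel the nonzero constant [\det P]. *)
Lemma char_poly_intertwine (F : fieldType) m (P A B : 'M[F]_m) :
  P \in unitmx -> P *m A = B *m P -> char_poly A = char_poly B.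
Proof.
move=> Pu PA; pose P' := map_mx (@polyC F) P.
have eqP : P' *m char_poly_mx A = char_poly_mx B *m P'.
  by rewrite mulmxBr mulmxBl -!map_mxM PA scalar_mxC.
have detP : \det P' != 0.
  by rewrite (det_map_mx (@polyC F)) polyC_eq0 -unitfE -unitmxE.
apply: (mulfI detP); rewrite /char_poly -det_mulmx eqP det_mulmx.
exact: mulrC.
Qed.

(** A sum of squares vanishes only termwise; this is what makes a subspace meet its orthogonal
    complement trivially. *)
Lemma row_norm_eq0 (R : realDomainType) m (u : 'rV[R]_m) :
  (u *m u^T == 0) = (u == 0).
Proof.
apply/eqP/eqP=> [/matrixP /(_ 0 0)|->]; last by rewrite mul0mx.
rewrite !mxE => sum0; apply/rowP=> i; rewrite mxE; apply/eqP.
rewrite -sqrf_eq0 expr2 -{2}[u]trmxK mxE.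
by rewrite (psumr_eq0P _ sum0) // => j _; rewrite mxE -expr2 sqr_ge0.
Qed.

(* In a basis adapted to the eigenspace X and its orthogonal complement Y,     *)
(* which is invariant by symmetry, A is block diagonal and the block on Y does *)
(* not have the eigenvalue a.                                                  *)
Lemma mup_char_poly_split (R : realFieldType) r k (A : 'M[R]_(r + k)) (a : R) :
  A^T = A -> \rank (eigenspace A a) = r -> mup a (char_poly A) = r.
Proof.
move=> symA rkE; set E := eigenspace A a in rkE.
have [X defX] : exists X : 'M_(r, r + k), (X :=: E)%MS.
  by move: (row_base E) (eq_row_base E); rewrite rkE => X ?; exists X.
have rkX : \rank X = r by rewrite defX.
have rkK : \rank (kermx X^T) = k by rewrite mxrank_ker mxrank_tr rkX addKn.
have [Y defY] : exists Y : 'M_(k, r + k), (Y :=: kermx X^T)%MS.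
  move: (row_base (kermx X^T)) (eq_row_base (kermx X^T)).
  by rewrite rkK => Y ?; exists Y.
have XA : X *m A = a *: X by apply/eigenspaceP; rewrite -/E defX.
have YX : Y *m X^T = 0 by apply/sub_kermxP; rewrite defY.
have cap0 (u : 'rV_(r + k)) : (u <= X)%MS -> (u <= Y)%MS -> u = 0.
  move=> /submxP[x ux] /submxP[y uy]; apply/eqP; rewrite -row_norm_eq0.
  by rewrite {2}ux uy trmx_mul mulmxA -(mulmxA y) YX mulmx0 mul0mx.
have capXY : (X :&: Y)%MS = 0.
  apply/eqP; rewrite -submx0; apply/rV_subP=> u; rewrite sub_capmx.
  by case/andP=> uX uY; rewrite (cap0 u) ?sub0mx.
pose P := col_mx X Y.
have Pu : P \in unitmx.
  rewrite -row_free_unit -row_leq_rank -addsmxE mxrank_disjoint_sum //.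
  by rewrite rkX defY rkK.
(* Invariance of the complement: by symmetry [Y *m A *m X^T] is [Y *m (X *m A)^T], that is
   [a *: (Y *m X^T)], which is 0. *)
have [C YA] : exists C, Y *m A = C *m Y.
  apply/submxP; rewrite defY; apply/sub_kermxP.
  by rewrite -mulmxA -{1}symA -trmx_mul XA linearZ -scalemxAr YX scaler0.
have freeY : row_free Y by rewrite /row_free defY rkK.
(* An eigenvector [v] of [C] for [a] would put [v *m Y] in both the eigenspace and its
   complement. *)
have NrootC : ~~ root (char_poly C) a.
  rewrite -eigenvalue_root_char; apply/eigenvalueP=> -[v vC]; apply/negP.
  rewrite negbK; apply/eqP/(row_free_inj freeY); rewrite mul0mx.
  apply: cap0; last exact: submxMl.
  by rewrite defX; apply/eigenspaceP; rewrite -mulmxA YA mulmxA vC -scalemxAl.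
rewrite (@char_poly_intertwine _ _ P A (block_mx a%:M 0 0 C)) //; last first.
  by rewrite mul_col_mx mul_block_col XA YA !mul0mx addr0 add0r mul_scalar_mx.
rewrite /char_poly char_block_diag_mx det_lblock mupMl //.
by rewrite /char_poly_mx map_scalar_mx -raddfB /= det_scalar mup_XsubCX eqxx.
Qed.

(** The size is rewritten as [r + k], with [r] the dimension of the eigenspace, so that the block
    decomposition is well typed. *)
Lemma mup_char_poly_sym (R : realFieldType) m (A : 'M[R]_m) (a : R) :
  A^T = A -> mup a (char_poly A) = \rank (eigenspace A a).
Proof.
move=> symA; have [r rkE] : exists r, \rank (eigenspace A a) = r by eexists.
have [k mE] : exists k, m = (r + k)%N.
  by exists (m - r)%N; rewrite subnKC // -rkE rank_leq_row.
by subst m; rewrite rkE; apply: mup_char_poly_split.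
Qed.

Notation o0 := (@Ordinal 6 0 isT).
Notation o1 := (@Ordinal 6 1 isT).
Notation o2 := (@Ordinal 6 2 isT).
Notation o3 := (@Ordinal 6 3 isT).
Notation o4 := (@Ordinal 6 4 isT).
Notation o5 := (@Ordinal 6 5 isT).

(** A case analysis that yields closed ordinals, on which matches and boolean tests compute. *)
Lemma ord6P (P : 'I_6 -> Prop) :
  P o0 -> P o1 -> P o2 -> P o3 -> P o4 -> P o5 -> forall l, P l.
Proof.
move=> P0 P1 P2 P3 P4 P5 [l lt_l6].
case: l lt_l6 => [|[|[|[|[|[|//]]]]]] lt_l6.
all: by rewrite (bool_irrelevance lt_l6 isT).
Qed.

Section Necklace.
Variable n : nat.
Local Notation V := ('I_n * 'I_6)%type.

(** Labels 0 to 4 form a copy of K5 and label 5 is the connector to the next copy in cyclic order.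
    With explicit lists, degrees are sizes and the eigenvalue equations unfold into short sums. *)
Definition neighbors (v : V) : seq V :=
  let: (k, l) := v in
  match val l with
  | 0 => [:: (k, o1); (k, o2); (k, o3); (k, o4); (k, o5)]
  | 1 => [:: (k, o0); (k, o2); (k, o3); (k, o4); (k, o5)]
  | 2 => [:: (k, o0); (k, o1); (k, o3); (k, o4); (ord_pred k, o5)]
  | 3 => [:: (k, o0); (k, o1); (k, o2); (k, o4); (ord_pred k, o5)]
  | 4 => [:: (k, o0); (k, o1); (k, o2); (k, o3)]
  | _ => [:: (k, o0); (k, o1); (ordS k, o2); (ordS k, o3)]
  end.

Definition color (v : V) : 'I_3 := inord (nth 0 [:: 0; 1; 0; 1; 0; 2] v.2).

Definition color_sign (R : pzRingType) (u v : V) : R :=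
  if color u == color v then 1 else -1.

Definition adjacent : rel V := fun u v => v \in neighbors u.

Lemma ord_pred_eq (i j : 'I_n) : (i == ord_pred j) = (j == ordS i).
Proof. by apply/eqP/eqP=> ->; rewrite ?ordSK ?ord_predK. Qed.

Lemma adjacent_sym : symmetric adjacent.
Proof.
move=> [k l] [i j]; elim/ord6P: l; elim/ord6P: j.
all: rewrite /adjacent !inE !xpair_eqE /= ?andbF ?andbT ?orbF //.
all: by rewrite ?ord_pred_eq // eq_sym.
Qed.

Lemma adjacent_irr : irreflexive adjacent.
Proof.
move=> [k l]; elim/ord6P: l.
all: by rewrite /adjacent !inE !xpair_eqE /= ?andbF.
Qed.

Lemma same_color_sym (u v : V) :
  adjacent u v -> (color u == color v) = (color v == color u).
Proof. by rewrite eq_sym. Qed.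

Definition necklace : sgraph V :=
  SGraph adjacent_sym adjacent_irr same_color_sym.

Lemma uniq_neighbors v : uniq (neighbors v).
Proof.
case: v => k l; elim/ord6P: l.
all: by rewrite /= !inE !xpair_eqE /= !andbF.
Qed.

Lemma necklace_degree v : degree necklace v = size (neighbors v).
Proof. by rewrite /degree cardsE; apply/card_uniqP/uniq_neighbors. Qed.

Lemma necklace_max_degree : (0 < n)%N -> max_degree necklace = 5.
Proof.
move=> n_gt0; apply/eqP; rewrite eqn_leq; apply/andP; split.
  apply/bigmax_leqP=> -[k l] _; rewrite necklace_degree.
  by elim/ord6P: l.
apply: leq_trans (leq_bigmax (Ordinal n_gt0, o0)).
by rewrite necklace_degree.
Qed.

Lemma necklace_connected : connected_sgraph necklace.
Proof.
have csym : connect_sym adjacent by apply: sym_connect_sym adjacent_sym.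
have hub (k : 'I_n) l : connect adjacent (k, o0) (k, l).
  elim/ord6P: l; rewrite ?connect0 //; apply: connect1;
    by rewrite /adjacent !inE !xpair_eqE eqxx /= ?orbT.
have next (k : 'I_n) : connect adjacent (k, o0) (ordS k, o0).
  apply: connect_trans (hub k o5) _.
  rewrite csym; apply: connect_trans (hub (ordS k) o2) _.
  by apply: connect1; rewrite /adjacent !inE !xpair_eqE ordSK !eqxx /= ?orbT.
move=> [k l] [i j]; have n_gt0 : (0 < n)%N by apply: leq_ltn_trans (ltn_ord k).
suff from0 (i' : 'I_n) : connect adjacent (Ordinal n_gt0, o0) (i', o0).
  have to0 i' j' : connect adjacent (Ordinal n_gt0, o0) (i', j').
    exact: connect_trans (from0 i') (hub i' j').
  by apply: connect_trans (to0 i j); rewrite csym.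
case: i' => m; elim: m => [|m IHm] lt_mn.
  by rewrite (bool_irrelevance lt_mn n_gt0) connect0.
apply: connect_trans (IHm (ltnW lt_mn)) _.
(* As [m.+1 < n], the cyclic successor does not wrap around here. *)
suff -> : Ordinal lt_mn = ordS (Ordinal (ltnW lt_mn)) by apply: next.
by apply: val_inj; rewrite /= modn_small.
Qed.

Lemma color_valid : valid_coloring necklace color.
Proof.
move=> u v; rewrite /neg_edge /pos_edge /=.
by split=> /andP[_] /eqP.
Qed.

(** For the lower bound, a connector and its two neighbors in its own copy span a triangle of
    negative edges. *)
Lemma necklace_chromatic : (0 < n)%N -> chromatic_number necklace 3.
Proof.
move=> n_gt0; split; first by exists color; apply: color_valid.
move=> s [c c_valid]; pose k := Ordinal n_gt0.
have neq l m : neg_edge necklace (k, l) (k, m) -> c (k, l) != c (k, m).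
  by move=> neg; apply/eqP; apply: (c_valid _ _).1.
have uniq_c : uniq [:: c (k, o0); c (k, o1); c (k, o5)].
  by rewrite /= !inE negb_or !neq // /neg_edge /= -val_eqE /= !inordK.
have := max_card (mem [:: c (k, o0); c (k, o1); c (k, o5)]).
by rewrite (card_uniqP uniq_c) card_ord.
Qed.

Section Spectrum.
Variable R : realType.
Implicit Types (f : V -> R) (mu : R).
Local Notation A := (signed_adjacency necklace R).

Lemma necklace_adjacencyE u v :
  A (enum_rank u) (enum_rank v) = if adjacent v u then color_sign R u v else 0.
Proof.
rewrite mxE !enum_rankK /pos_edge /neg_edge /= adjacent_sym /color_sign.
by case: (adjacent v u); case: (color u == color v).
Qed.

Lemma necklace_adjacency_sym : A^T = A.
Proof.
apply/matrixP=> i j; rewrite mxE -[i]enum_valK -[j]enum_valK.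
by rewrite !necklace_adjacencyE adjacent_sym /color_sign eq_sym.
Qed.

Lemma mul_necklace_adjacency (x : 'rV[R]_#|{: V}|) v :
  (x *m A) 0 (enum_rank v) =
    \sum_(u <- neighbors v) color_sign R u v * x 0 (enum_rank u).
Proof.
rewrite mxE (reindex enum_rank) /=; last first.
  by apply: onW_bij; apply: enum_rank_bij.
rewrite (big_uniq _ (uniq_neighbors v)) [RHS]big_mkcond /=.
apply: eq_bigr => u _; rewrite necklace_adjacencyE mulrC /adjacent.
by case: ifP; rewrite ?mul0r.
Qed.

(* The eigenvalue equations, with those at (k, 2) and (k, 3) shifted to block  *)
(* k + 1 so that a single index k gathers the equations involving (k, 5).      *)
Definition local_equations mu f := forall k : 'I_n,
  [/\ mu * f (k, o0) = - f (k, o1) + f (k, o2) - f (k, o3) + f (k, o4)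
                       - f (k, o5),
      mu * f (k, o1) = - f (k, o0) - f (k, o2) + f (k, o3) - f (k, o4)
                       - f (k, o5) &
      [/\ mu * f (ordS k, o2) = f (ordS k, o0) - f (ordS k, o1)
                       - f (ordS k, o3) + f (ordS k, o4) - f (k, o5),
      mu * f (ordS k, o3) = - f (ordS k, o0) + f (ordS k, o1)
                       - f (ordS k, o2) - f (ordS k, o4) - f (k, o5),
      mu * f (k, o4) = f (k, o0) - f (k, o1) + f (k, o2) - f (k, o3) &
      mu * f (k, o5) = - f (k, o0) - f (k, o1) - f (ordS k, o2)
                       - f (ordS k, o3)]].

Lemma local_equationsP mu (x : 'rV[R]_#|{: V}|) :
  x *m A = mu *: x <-> local_equations mu (fun v => x 0 (enum_rank v)).
Proof.
have eqsP : x *m A = mu *: x <-> forall v, mu * x 0 (enum_rank v) =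
    \sum_(u <- neighbors v) color_sign R u v * x 0 (enum_rank u).
  split=> [/rowP xA v|eqs].
    by rewrite -mul_necklace_adjacency xA mxE.
  apply/rowP=> i; rewrite -[i]enum_valK mul_necklace_adjacency mxE.
  by rewrite -eqs.
rewrite eqsP; split=> [eqs k|eqs [k l]].
  split; last split; rewrite eqs /= !big_cons big_nil ?ordSK;
    by rewrite /color_sign -!val_eqE /= !inordK //=; ring.
have [e0 e1 [_ _ e4 e5]] := eqs k.
have [_ _ [e2 e3 _ _]] := eqs (ord_pred k); rewrite ord_predK in e2 e3.
elim/ord6P: l; rewrite ?(e0, e1, e2, e3, e4, e5) /= !big_cons big_nil;
  by rewrite /color_sign -!val_eqE /= !inordK //=; ring.
Qed.

(** The bound on [mu] makes [mu + 1] and [mu * (mu + 1) - 4] invertible. The factor [mu - 4] is kept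
    in the conclusion so that it serves both [mu = 4] and [mu > 4]. *)
Lemma local_equations_solution mu f : 4 <= mu -> local_equations mu f ->
  forall k, [/\ f (k, o5) = 0,
      [/\ f (k, o1) = - f (k, o0), f (k, o2) = f (k, o0),
          f (k, o3) = - f (k, o0) & f (k, o4) = f (k, o0)] &
      (mu - 4) * f (k, o0) = 0].
Proof.
move=> mu_ge4 eqs.
have mu1 : mu + 1 != 0 by apply/negP=> /eqP; lra.
have w0 k : f (k, o5) = 0.
  have [e0 e1 [e2 e3 _ e5]] := eqs k.
  have mu_sqr : 4 * 5 <= mu * (mu + 1) by apply: ler_pM; lra.
  have mu_neq : mu * (mu + 1) - 4 != 0 by apply/negP=> /eqP; lra.
  (* Labels 0 and 1 have opposite signs after switching, so adding their equations cancels the rest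
     of the copy and leaves only the connector; likewise for labels 2 and 3. *)
  have h01 : (mu + 1) * (f (k, o0) + f (k, o1)) = - 2 * f (k, o5) by lra.
  have h23 : (mu + 1) * (f (ordS k, o2) + f (ordS k, o3)) = - 2 * f (k, o5).
    by lra.
  apply: (mulfI mu_neq); rewrite mulr0 mulrBl mulrAC e5.
  by transitivity (- ((mu + 1) * (f (k, o0) + f (k, o1)))
      - (mu + 1) * (f (ordS k, o2) + f (ordS k, o3)) - 4 * f (k, o5));
    [ring | rewrite h01 h23; ring].
move=> k; have [e0 e1 [_ _ e4 _]] := eqs k.
have [_ _ [e2 e3 _ _]] := eqs (ord_pred k); rewrite ord_predK in e2 e3.
rewrite w0 subr0 in e0 e1; rewrite w0 subr0 in e2 e3.
(* Once the connectors vanish, the switched copy is a plain K5: the difference of two of its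
   equations is [mu + 1] times the difference of two values. *)
have h1 : f (k, o1) = - f (k, o0) by apply: (mulfI mu1); lra.
have h2 : f (k, o2) = f (k, o0) by apply: (mulfI mu1); lra.
have h3 : f (k, o3) = - f (k, o0) by apply: (mulfI mu1); lra.
have h4 : f (k, o4) = f (k, o0) by apply: (mulfI mu1); lra.
by split=> //; rewrite mulrBl e0 h1 h2 h3 h4; ring.
Qed.

(** The switching function of a copy, 1 on one color and -1 on the other, extended by 0 to the
    connector. *)
Definition block_sign (l : 'I_6) : R := nth 0 [:: 1; -1; 1; -1; 1; 0] l.

Definition block_eigenvectors : 'M[R]_(n, #|{: V}|) :=
  \matrix_(k, i) (((enum_val i).1 == k)%:R * block_sign (enum_val i).2).

Lemma row_free_block_eigenvectors : row_free block_eigenvectors.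
Proof.
(* The right inverse reads off the coordinate at [(k, o0)], where [block_sign] is 1. *)
apply/row_freeP; exists (\matrix_(i, k) (enum_val i == (k, o0))%:R).
apply/matrixP=> k k'; rewrite !mxE (bigD1 (enum_rank (k', o0))) //= big1.
  by rewrite !mxE enum_rankK eqxx /= /block_sign /= !mulr1 addr0 eq_sym.
move=> i; rewrite !mxE -(inj_eq enum_val_inj) enum_rankK => /negPf->.
by rewrite mulr0.
Qed.

Lemma eigenspace_necklace : (eigenspace A 4 :=: block_eigenvectors)%MS.
Proof.
apply/eqmxP/andP; split; last first.
  apply/row_subP=> k; apply/eigenspaceP/local_equationsP=> i.
  by rewrite !mxE !enum_rankK /= /block_sign /=; split; last split; ring.
apply/rV_subP=> x /eigenspaceP/local_equationsP eqs.
have sol := local_equations_solution (lexx 4) eqs.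
(* The value at [(k, o0)] determines the solution on copy [k], hence is its coefficient. *)
apply/submxP; exists (\row_k x 0 (enum_rank (k, o0))); apply/rowP=> i.
rewrite -[i]enum_valK mxE; case: (enum_val i) => k l.
rewrite (bigD1 k) //= big1 => [|k' /negPf k'k]; last first.
  by rewrite !mxE enum_rankK /= eq_sym k'k mul0r mulr0.
have [s5 [s1 s2 s3 s4] _] := sol k.
rewrite !mxE enum_rankK eqxx /= /block_sign.
by elim/ord6P: l; rewrite /= ?(s1, s2, s3, s4, s5); ring.
Qed.

Lemma necklace_multiplicity : eigenvalue_multiplicity A 4 = n.
Proof.
rewrite /eigenvalue_multiplicity mup_char_poly_sym ?necklace_adjacency_sym //.
by rewrite eigenspace_necklace; apply/eqP: row_free_block_eigenvectors.
Qed.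

Lemma necklace_largest_eigenvalue : (0 < n)%N -> largest_eigenvalue A 4.
Proof.
move=> n_gt0; split.
  rewrite /eigenvalue -mxrank_eq0 eigenspace_necklace.
  by rewrite (eqP row_free_block_eigenvectors) -lt0n.
move=> mu /eigenvalueP[x /local_equationsP eqs]; apply: contraNT.
rewrite -ltNge => mu_gt4; apply/eqP/rowP=> i; rewrite mxE.
rewrite -[i]enum_valK; case: (enum_val i) => k l.
have [s5 [s1 s2 s3 s4] /eqP] := local_equations_solution (ltW mu_gt4) eqs k.
rewrite mulf_eq0 subr_eq0 gt_eqF //= => /eqP s0.
by elim/ord6P: l; rewrite ?(s1, s2, s3, s4, s5) ?s0 ?oppr0.
Qed.

End Spectrum.
End Necklace.

Theorem theorem1p15 (R : realType) (n : nat) (hn : (3 <= n)%N) :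
  exists (V : finType) (G : sgraph V),
    #|V| = (6 * n)%N /\
    connected_sgraph G /\
    max_degree G = 5%N /\
    chromatic_number G 3 /\
    exists lam : R,
      largest_eigenvalue (signed_adjacency G R) lam /\
      eigenvalue_multiplicity (signed_adjacency G R) lam = n.
Proof.
have n_gt0 : (0 < n)%N := ltnW (ltnW hn).
exists ('I_n * 'I_6)%type, (necklace n); split.
  by rewrite card_prod !card_ord mulnC.
split; first exact: necklace_connected.
split; first exact: necklace_max_degree.
split; first exact: necklace_chromatic.
exists 4; split; first exact: necklace_largest_eigenvalue.
exact: necklace_multiplicity.
Qed.
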